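(* Let $(M_i,g_i)$, $i=1,2$, be Riemannian manifolds, let $f_i$ be a positive smooth function on $M_i$, and let $c$ be an arbitrary real number. Then the symmetric tensor field $G_{f_1f_2}=(f_2^v)^2\pi_1^*g_1+(f_1^h)^2\pi_2^*g_2+c f_1^hf_2^v\,df_1^h\odot df_2^v$ is a Riemannian metric on $M_1\times M_2$ if and only if $$0\le c^2\, g_1(\mathrm{grad} f_1,\mathrm{grad} f_1)^h\, g_2(\mathrm{grad} f_2,\mathrm{grad} f_2)^v<1$$ at every point of $M_1\times M_2$.
   Context: Manifolds are smooth and connected. $\pi_i:M_1\times M_2\to M_i$ are the projections. For a function $\varphi_1$ on $M_1$, $\varphi_1^h=\varphi_1\circ\pi_1$ (horizontal lift); for a function $\varphi_2$ on $M_2$, $\varphi_2^v=\varphi_2\circ\pi_2$ (vertical lift). $\mathrm{grad} f_i$ is the gradient of $f_i$ with respect to $g_i$. For 1-forms, $\alpha\odot\beta=\alpha\otimes\beta+\beta\otimes\alpha$. *)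

(* Defs.v *)
From HB Require Import structures.
From mathcomp Require Import all_boot all_order all_algebra.
From mathcomp Require Import all_classical all_reals all_analysis.

Set Implicit Arguments.
Unset Strict Implicit.
Unset Printing Implicit Defensive.

Import Order.TTheory GRing.Theory Num.Theory.
Import numFieldNormedType.Exports.

Local Open Scope classical_set_scope.
Local Open Scope ring_scope.

(** [U] is meant to be open.  On a finite-dimensional space this is the usual
    class C^k: [k.+1] asks that [f] be differentiable on [U] and that all its
    directional derivatives be C^k on [U]. *)
Fixpoint Ck (R : realType) (V W : normedModType R) (k : nat) (U : set V)
    (f : V -> W) : Prop :=
  match k with
  | 0%N => forall x, U x -> {for x, continuous f}
  | k'.+1 => (forall x, U x -> differentiable f x) /\
             (forall v : V, Ck k' U ('D_v f))
  end.

Definition smooth_on (R : realType) (V W : normedModType R) (U : set V)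
    (f : V -> W) : Prop := forall k, Ck k U f.

(** [coord] and [par] are total functions; they are inverse homeomorphisms
    between [dom] and [cod], and their values elsewhere are irrelevant. *)
Record chart (R : realType) (n : nat) (T : topologicalType) := Chart {
  dom : set T;
  cod : set 'rV[R]_n;
  coord : T -> 'rV[R]_n;
  par : 'rV[R]_n -> T;
  open_dom : open dom;
  open_cod : open cod;
  coord_cod : forall p, dom p -> cod (coord p);
  par_dom : forall x, cod x -> dom (par x);
  coordK : forall p, dom p -> par (coord p) = p;
  parK : forall x, cod x -> coord (par x) = x;
  coord_continuous : forall p, dom p -> {for p, continuous coord};
  par_continuous : forall x, cod x -> {for x, continuous par} }.

(** Connected smooth manifolds of dimension [n].  The atlas need not be maximal.
    [chart_at p] is a chosen chart around [p]; it only serves to represent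
    tangent vectors at [p] (see [tangent]). *)
Record manifold (R : realType) (n : nat) := Manifold {
  carrier :> topologicalType;
  atlas : set (chart R n carrier);
  chart_at : carrier -> chart R n carrier;
  chart_at_atlas : forall p, atlas (chart_at p);
  mem_chart_at : forall p, dom (chart_at p) p;
  chart_compat : forall a b, atlas a -> atlas b ->
    smooth_on (coord a @` (dom a `&` dom b)) (coord b \o par a);
  manifold_hausdorff : hausdorff_space carrier;
  manifold_second_countable : @second_countable carrier;
  manifold_connected : connected [set: carrier] }.

Definition smooth_function (R : realType) (n : nat) (M : manifold R n)
    (f : M -> R) : Prop :=
  forall a, atlas a -> smooth_on (cod a) (f \o par a).

(** A tangent vector at [p] is represented by its components in the chart
    [chart_at p]; its components in any other chart [a] around [p] are obtained
    by applying the differential of the change of coordinates, whose inverse is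
    [chart_vector a]. *)
Definition tangent (R : realType) (n : nat) (M : manifold R n) (p : M) :
  lmodType R := 'rV[R]_n.

(** The tangent vector at [par a x] whose components in the chart [a] are [u]. *)
Definition chart_vector (R : realType) (n : nat) (M : manifold R n)
    (a : chart R n M) (x u : 'rV[R]_n) : tangent (par a x) :=
  'd (coord (chart_at (par a x)) \o par a) x u.

Definition tangent_map (R : realType) (m n : nat) (M : manifold R m)
    (N : manifold R n) (F : M -> N) (p : M) (u : tangent p) : tangent (F p) :=
  'd (coord (chart_at (F p)) \o F \o par (chart_at p)) (coord (chart_at p) p) u.

Definition one_form (R : realType) (n : nat) (M : manifold R n) :=
  forall p : M, tangent p -> R.

Definition tensor2 (R : realType) (n : nat) (M : manifold R n) :=
  forall p : M, tangent p -> tangent p -> R.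

Definition differential (R : realType) (n : nat) (M : manifold R n)
    (f : M -> R) : one_form M :=
  fun p u => 'd (f \o par (chart_at p)) (coord (chart_at p) p) u.

Definition tensor_product (R : realType) (n : nat) (M : manifold R n)
    (alpha beta : one_form M) : tensor2 M :=
  fun p u v => alpha p u * beta p v.

Definition symmetric_product (R : realType) (n : nat) (M : manifold R n)
    (alpha beta : one_form M) : tensor2 M :=
  fun p u v => tensor_product alpha beta u v + tensor_product beta alpha u v.

Definition pullback (R : realType) (m n : nat) (M : manifold R m)
    (N : manifold R n) (F : M -> N) (g : tensor2 N) : tensor2 M :=
  fun p u v => g (F p) (tangent_map F u) (tangent_map F v).

(** Smoothness is smoothness of the components of [g] in every chart of the
    atlas. *)
Record riemannian_metric (R : realType) (n : nat) (M : manifold R n)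
    (g : tensor2 M) : Prop := RiemannianMetric {
  metric_linear : forall (p : M) (k : R) (u v w : tangent p),
    g p (k *: u + v) w = k * g p u w + g p v w;
  metric_symmetric : forall (p : M) (u v : tangent p), g p u v = g p v u;
  metric_positive : forall (p : M) (u : tangent p), u != 0 -> 0 < g p u u;
  metric_smooth : forall (a : chart R n M) (u v : 'rV[R]_n), atlas a ->
    smooth_on (cod a)
      (fun x => g (par a x) (chart_vector a x u) (chart_vector a x v)) }.

(** The vector field with [g (grad f, v) = df v] for all [v]; it exists and is
    unique when [g] is a Riemannian metric. *)
Definition grad (R : realType) (n : nat) (M : manifold R n) (g : tensor2 M)
    (f : M -> R) (p : M) : tangent p :=
  xget 0 [set u : tangent p |
    forall v : tangent p, g p u v = differential f v].

Definition grad_norm2 (R : realType) (n : nat) (M : manifold R n)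
    (g : tensor2 M) (f : M -> R) : M -> R :=
  fun p => g p (grad g f p) (grad g f p).

Section CkTheory.
Context {R : realType}.
Implicit Types V W : normedModType R.

Lemma near_eq_differentiable V W (f g : V -> W) (x : V) :
  (\near x, f x = g x) -> differentiable f x -> differentiable g x.
Proof.
move=> fg /diff_locallyP[cf df].
have fgx : f x = g x by exact: nbhs_singleton fg.
have dg : g \o shift x = cst (g x) + 'd f x +o_ (0 : V) id.
  apply/eqaddoP => e e0.
  move: df => /eqaddoP/(_ e e0) dfe.
  have fg0 : \forall y \near (0 : V), f (y + x) = g (y + x).
    by move: fg; rewrite (near_shift 0 x) subr0.
  near=> y.
  have -> : (g \o shift x - (cst (g x) + 'd f x)) y =
            (f \o shift x - (cst (f x) + 'd f x)) y.
    have E : f (y + x) = g (y + x) by near: y.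
    by rewrite /= !fctE /= fgx /shift /= E.
  by near: y.
apply/diff_locallyP.
by rewrite (diff_unique cf dg).
Unshelve. all: by end_near. Qed.

Lemma open_eq_near V W (U : set V) (f g : V -> W) :
  open U -> (forall x, U x -> f x = g x) ->
  forall x, U x -> \near x, f x = g x.
Proof.
by move=> oU fg x Ux; apply: filterS (open_nbhs_nbhs (conj oU Ux)) => y /fg.
Qed.

Lemma eq_Ck V W k (U : set V) (f g : V -> W) :
  open U -> (forall x, U x -> f x = g x) -> Ck k U f -> Ck k U g.
Proof.
move=> oU; elim: k f g => [|k IH] f g fg /=.
  move=> cf x Ux; have := cf _ Ux.
  rewrite /prop_for /continuous_at (fg _ Ux); apply: cvg_trans.
  by apply: near_eq_cvg; apply: open_eq_near Ux.
move=> [df Cf]; split=> [x Ux|v].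
  exact: near_eq_differentiable (open_eq_near oU fg Ux) (df _ Ux).
apply: IH (Cf v) => x Ux.
exact: near_eq_derive (open_eq_near oU fg Ux).
Qed.

Lemma CkD V W k (U : set V) (f g : V -> W) :
  open U -> Ck k U f -> Ck k U g -> Ck k U (f \+ g).
Proof.
move=> oU; elim: k f g => [|k IH] f g /=.
  by move=> cf cg x Ux; apply: cvgD; [exact: cf|exact: cg].
move=> [df Cf] [dg Cg]; split=> [x Ux|v].
  by apply: differentiableD; [exact: df|exact: dg].
apply: (@eq_Ck _ _ _ _ ('D_v f \+ 'D_v g)) (IH _ _ (Cf v) (Cg v)) => // x Ux.
by rewrite deriveD //; apply: diff_derivable; [exact: df|exact: dg].
Qed.

Lemma Ck_comp_linear V V' W k (U : set V') (f : V' -> W)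
    (L : {linear V -> V'}) :
  continuous L -> Ck k U f -> Ck k (L @^-1` U) (f \o L).
Proof.
move=> cL; elim: k f => [|k IH] f /=.
  by move=> cf x Ux; apply: continuous_comp; [exact: cL|exact: cf].
move=> [df Cf]; split=> [x Ux|v].
  by apply: differentiable_comp; [exact: linear_differentiable|exact: df].
have -> : 'D_v (f \o L) = 'D_(L v) f \o L; last exact: IH.
apply/funext => x; apply: (congr1 (fun u : R -> W => lim (u @ 0^'))).
by apply/funext => h; rewrite /= linearP.
Qed.

Lemma Ck_linear_comp V W W' k (U : set V) (f : V -> W)
    (L : {linear W -> W'}) :
  open U -> continuous L -> Ck k U f -> Ck k U (L \o f).
Proof.
move=> oU cL; elim: k f => [|k IH] f /=.
  by move=> cf x Ux; apply: continuous_comp; [exact: cf|exact: cL].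
move=> [df Cf]; split=> [x Ux|v].
  by apply: differentiable_comp; [exact: df|exact: linear_differentiable].
apply: eq_Ck (IH _ (Cf v)) => // x Ux.
have dL : differentiable L (f x) by exact: linear_differentiable.
have dLf : differentiable (L \o f) x.
  by apply: differentiable_comp => //; exact: df.
by rewrite /= (deriveE _ (df _ Ux)) (deriveE _ dLf) (diff_comp (df _ Ux) dL) diff_lin.
Qed.

Lemma sub_Ck V W k (U U' : set V) (f : V -> W) :
  U `<=` U' -> Ck k U' f -> Ck k U f.
Proof.
move=> UU'; elim: k f => [|k IH] f /=; first by move=> cf x /UU' /cf.
by move=> [df Cf]; split=> [x /UU' /df //|v]; exact: IH.
Qed.

Lemma cvg_row_mx (T : Type) (F : set_system T) {FF : Filter F} n1 n2
    (f : T -> 'rV[R]_n1) (g : T -> 'rV[R]_n2) (a : 'rV[R]_n1)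
    (b : 'rV[R]_n2) :
  f @ F --> a -> g @ F --> b ->
  (fun x => row_mx (f x) (g x)) @ F --> row_mx a b.
Proof.
move=> fa gb A /nbhs_ballP[e /= e0 eA].
have fF : \forall x \near F, ball a e (f x) by apply: fa; exact: nbhsx_ballx.
have gF : \forall x \near F, ball b e (g x) by apply: gb; exact: nbhsx_ballx.
apply: filterS2 fF gF => x [_ fx] [_ gx] /=; apply: eA; split=> // i j.
by rewrite !mxE; case: split_ordP => k _; [exact: fx|exact: gx].
Qed.

Lemma Ck_row_mx V k (U : set V) n1 n2 (f : V -> 'rV[R]_n1)
    (g : V -> 'rV[R]_n2) :
  open U -> Ck k U f -> Ck k U g -> Ck k U (fun x => row_mx (f x) (g x)).
Proof.
move=> oU Cf Cg.
pose L1 : 'rV[R]_n1 -> 'rV[R]_(n1 + n2) := mulmxr (row_mx 1%:M 0).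
pose L2 : 'rV[R]_n2 -> 'rV[R]_(n1 + n2) := mulmxr (row_mx 0 1%:M).
have L1E u : L1 u = row_mx u 0 by rewrite /L1 /= mul_mx_row mulmx1 mulmx0.
have L2E u : L2 u = row_mx 0 u by rewrite /L2 /= mul_mx_row mulmx1 mulmx0.
have cL1 : continuous L1.
  move=> u; rewrite /continuous_at L1E (funext L1E).
  apply: (@cvg_row_mx _ (nbhs u) _ _ _ id (cst 0)); first exact: cvg_id.
  exact: cvg_cst.
have cL2 : continuous L2.
  move=> u; rewrite /continuous_at L2E (funext L2E).
  apply: (@cvg_row_mx _ (nbhs u) _ _ _ (cst 0) id); first exact: cvg_cst.
  exact: cvg_id.
have -> : (fun x => row_mx (f x) (g x)) = (L1 \o f) \+ (L2 \o g).
  by apply/funext => x; rewrite /= L1E L2E add_row_mx addr0 add0r.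
by apply: CkD => //; exact: Ck_linear_comp.
Qed.

End CkTheory.

Section ProductTopology.
Implicit Types S T : topologicalType.

Lemma open_setX S T (A : set S) (B : set T) :
  open A -> open B -> open (A `*` B).
Proof.
move=> oA oB; rewrite openE => -[x y] [/= Ax By]; exists (A, B) => //=.
by split; apply: open_nbhs_nbhs.
Qed.

Lemma hausdorff_prod S T :
  hausdorff_space S -> hausdorff_space T -> hausdorff_space (S * T)%type.
Proof.
move=> hS hT [x1 y1] [x2 y2] cl; congr pair.
  apply: hS => A B nA nB.
  have [] := cl (A `*` setT) (B `*` setT).
  - by exists (A, setT) => //=; split=> //; exact: filterT.
  - by exists (B, setT) => //=; split=> //; exact: filterT.
  by move=> [x y] [[/= ? _] [/= ? _]]; exists x.
apply: hT => A B nA nB.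
have [] := cl (setT `*` A) (setT `*` B).
- by exists (setT, A) => //=; split=> //; exact: filterT.
- by exists (setT, B) => //=; split=> //; exact: filterT.
by move=> [x y] [[/= _ ?] [/= _ ?]]; exists y.
Qed.

Lemma second_countable_prod S T :
  @second_countable S -> @second_countable T ->
  @second_countable (S * T)%type.
Proof.
move=> [A cA [oA bA]] [B cB [oB bB]].
exists [set PQ.1 `*` PQ.2 | PQ in A `*` B].
  by apply: sub_countable (countableX cA cB); exact: card_image_le.
split=> [_ [[P Q] [/= AP BQ] <-]|[x y] D [[P Q] [/= nP nQ] PQD]].
  by apply: open_setX; [exact: oA|exact: oB].
have [P' [AP' P'x] P'P] := bA x _ nP.
have [Q' [BQ' Q'y] Q'Q] := bB y _ nQ.
exists (P' `*` Q'); first by split=> //; exists (P', Q').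
by move=> [u v] [/= /P'P Pu /Q'Q Qv]; exact: PQD.
Qed.

Lemma connected_prod S T :
  connected [set: S] -> connected [set: T] -> connected [set: S * T].
Proof.
move=> cS cT.
have [[[x0 y0] _]|] := pselect ([set: S * T] !=set0); last first.
  by move=> /set0P/negP/negPn/eqP ->; exact: connected0.
pose cross x : set (S * T) :=
  ((fun y => (x, y)) @` setT) `|` ((fun x => (x, y0)) @` setT).
have -> : [set: S * T] = \bigcup_(x in setT) cross x.
  by apply/seteqP; split=> // -[x y] _; exists x => //; left; exists y.
have cl (x : S) : continuous (fun y : T => (x, y)).
  by move=> y; apply: cvg_pair; [exact: cvg_cst|exact: cvg_id].
have cr (y : T) : continuous (fun x : S => (x, y)).
  by move=> x; apply: cvg_pair; [exact: cvg_id|exact: cvg_cst].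
apply: bigcup_connected; first by exists (x0, y0) => x _; right; exists x0.
move=> x _; apply: connectedU.
- by exists (x, y0); split; [exists y0|exists x].
- by apply: connected_continuous_connected => //; exact: continuous_subspaceT.
- by apply: connected_continuous_connected => //; exact: continuous_subspaceT.
Qed.

End ProductTopology.

Section ProductChart.
Context {R : realType} {m n : nat} {S T : topologicalType}.
Variables (a : chart R m S) (b : chart R n T).

Let pdom : set (S * T) := dom a `*` dom b.
Let pcod : set 'rV[R]_(m + n) := lsubmx @^-1` cod a `&` rsubmx @^-1` cod b.
Let pcoord (p : S * T) : 'rV[R]_(m + n) := row_mx (coord a p.1) (coord b p.2).
Let ppar (x : 'rV[R]_(m + n)) : S * T := (par a (lsubmx x), par b (rsubmx x)).

Fact prod_open_dom : open pdom.
Proof. by apply: open_setX; exact: open_dom. Qed.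

Fact prod_open_cod : open pcod.
Proof.
apply: openI; apply: open_comp => [x _|]; try exact: open_cod.
  exact: continuous_lsubmx.
exact: continuous_rsubmx.
Qed.

Fact prod_coord_cod p : pdom p -> pcod (pcoord p).
Proof.
by move=> [ap bp]; rewrite /pcod /pcoord; split;
  rewrite /= ?row_mxKl ?row_mxKr; exact: coord_cod.
Qed.

Fact prod_par_dom x : pcod x -> pdom (ppar x).
Proof. by move=> [ax bx]; split; exact: par_dom. Qed.

Fact prod_coordK p : pdom p -> ppar (pcoord p) = p.
Proof.
by case: p => p q [/= ap bq]; rewrite /ppar /pcoord row_mxKl row_mxKr !coordK.
Qed.

Fact prod_parK x : pcod x -> pcoord (ppar x) = x.
Proof. by move=> [/= ax bx]; rewrite /pcoord !parK ?hsubmxK. Qed.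

Fact prod_coord_continuous p : pdom p -> {for p, continuous pcoord}.
Proof.
move=> [ap bp].
apply: (@cvg_row_mx _ _ (nbhs p) _ _ _ (coord a \o fst) (coord b \o snd)).
  by apply: continuous_comp; [exact: cvg_fst|exact: coord_continuous].
by apply: continuous_comp; [exact: cvg_snd|exact: coord_continuous].
Qed.

Fact prod_par_continuous x : pcod x -> {for x, continuous ppar}.
Proof.
move=> [ax bx].
apply: (@cvg_pair _ _ _ (nbhs x) (nbhs (par a (lsubmx x)))
  (nbhs (par b (rsubmx x))) _ _ _ (par a \o lsubmx) (par b \o rsubmx)).
  by apply: continuous_comp; [exact: continuous_lsubmx|exact: par_continuous].
by apply: continuous_comp; [exact: continuous_rsubmx|exact: par_continuous].
Qed.

Definition prod_chart : chart R (m + n) (S * T)%type :=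
  Chart prod_open_dom prod_open_cod prod_coord_cod prod_par_dom prod_coordK
    prod_parK prod_coord_continuous prod_par_continuous.

End ProductChart.

Lemma overlapE (R : realType) (n : nat) (T : topologicalType)
    (a b : chart R n T) :
  coord a @` (dom a `&` dom b) = cod a `&` par a @^-1` dom b.
Proof.
apply/seteqP; split=> [_ [p [ap bp] <-]|x [ax bx]].
  by split; [exact: coord_cod|rewrite /= coordK].
by exists (par a x); [split; [exact: par_dom|]|exact: parK].
Qed.

Lemma open_overlap (R : realType) (n : nat) (T : topologicalType)
    (a b : chart R n T) :
  open (coord a @` (dom a `&` dom b)).
Proof.
rewrite overlapE openE => x [ax bx]; apply: filterI.
  by apply: open_nbhs_nbhs; split=> //; exact: open_cod.
apply: (par_continuous ax); apply: open_nbhs_nbhs; split=> //.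
exact: open_dom.
Qed.

Section ProductManifold.
Context {R : realType} {m n : nat}.
Variables (M1 : manifold R m) (M2 : manifold R n).

Let patlas : set (chart R (m + n) (M1 * M2)%type) :=
  [set prod_chart ab.1 ab.2 | ab in @atlas _ _ M1 `*` @atlas _ _ M2].
Let pchart_at (p : M1 * M2) : chart R (m + n) (M1 * M2)%type :=
  prod_chart (chart_at p.1) (chart_at p.2).

Fact prod_chart_at_atlas p : patlas (pchart_at p).
Proof.
by exists (chart_at p.1, chart_at p.2) => //; split; exact: chart_at_atlas.
Qed.

Fact prod_mem_chart_at p : dom (pchart_at p) p.
Proof. by split; exact: mem_chart_at. Qed.

Fact prod_chart_compat c d : patlas c -> patlas d ->
  smooth_on (coord c @` (dom c `&` dom d)) (coord d \o par c).
Proof.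
move=> [[a b] [/= Aa Ab] <-] [[a' b'] [/= Aa' Ab'] <-] k.
have oU := @open_overlap _ _ _ (prod_chart a b) (prod_chart a' b').
apply: (@Ck_row_mx _ _ _ _ _ _ (coord a' \o par a \o lsubmx)
                               (coord b' \o par b \o rsubmx)) => //.
  apply: sub_Ck (Ck_comp_linear _ (chart_compat Aa Aa' k)).
    move=> _ [[p q] [[/= ? ?] [/= ? ?]] <-] /=; rewrite row_mxKl.
    by exists p.
  exact: continuous_lsubmx.
apply: sub_Ck (Ck_comp_linear _ (chart_compat Ab Ab' k)).
  move=> _ [[p q] [[/= ? ?] [/= ? ?]] <-] /=; rewrite row_mxKr.
  by exists q.
exact: continuous_rsubmx.
Qed.

Definition prod_manifold : manifold R (m + n) :=
  Manifold prod_chart_at_atlas prod_mem_chart_at prod_chart_compat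
    (hausdorff_prod (@manifold_hausdorff _ _ M1) (@manifold_hausdorff _ _ M2))
    (second_countable_prod (@manifold_second_countable _ _ M1)
       (@manifold_second_countable _ _ M2))
    (connected_prod (@manifold_connected _ _ M1) (@manifold_connected _ _ M2)).

Definition projection1 : prod_manifold -> M1 := fst.
Definition projection2 : prod_manifold -> M2 := snd.

Definition horizontal_lift (phi : M1 -> R) : prod_manifold -> R :=
  phi \o projection1.
Definition vertical_lift (phi : M2 -> R) : prod_manifold -> R :=
  phi \o projection2.

Definition doubly_warped_tensor (g1 : tensor2 M1) (g2 : tensor2 M2)
    (f1 : M1 -> R) (f2 : M2 -> R) (c : R) : tensor2 prod_manifold :=
  fun p u v =>
    vertical_lift f2 p ^+ 2 * pullback projection1 g1 u v
    + horizontal_lift f1 p ^+ 2 * pullback projection2 g2 u v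
    + c * horizontal_lift f1 p * vertical_lift f2 p
      * symmetric_product (differential (horizontal_lift f1))
          (differential (vertical_lift f2)) u v.

End ProductManifold.

(* Main.v *)
(** Identify a tangent vector of the product with a pair (u1, u2). Since
    df_i(u_i) = g_i(grad f_i, u_i), the Cauchy-Schwarz inequality bounds the
    cross term 2c f1 f2 df1(u1) df2(u2) by 2 f1 f2 |c| |grad f1| |grad f2|
    |u1| |u2|, and the arithmetic-geometric mean inequality shows that the two
    squares dominate it when |c| |grad f1| |grad f2| < 1. Conversely, on the
    vector (- c |grad f2|^2 / f2 grad f1, 1 / f1 grad f2) the tensor takes the
    value |grad f2|^2 (1 - c^2 |grad f1|^2 |grad f2|^2). *)
Require Import Defs.
From HB Require Import structures.
From mathcomp Require Import all_boot all_order all_algebra.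
From mathcomp Require Import all_classical all_reals all_analysis.
From mathcomp Require Import ring lra.

Import Order.TTheory GRing.Theory Num.Theory.
Import numFieldNormedType.Exports.
Local Open Scope classical_set_scope.
Local Open Scope ring_scope.

Local Notation coord := Defs.coord.

(** * Products, constants and differentials of C^k maps *)

Section Calculus.
Context {R : realType}.
Implicit Types V W : normedModType R.

Lemma CkW {V W k} {U : set V} {f : V -> W} : Ck k.+1 U f -> Ck k U f.
Proof.
elim: k f => [|k IH] f [df Cf]; first by move=> x /df /differentiable_continuous.
by split=> // v; exact: IH.
Qed.

(** Induction by the Leibniz rule. Its terms also contain [f] and [g] themselves, lowered by one
    order through [CkW]. *)
Lemma CkM {V k} {U : set V} {f g : V -> R} :
  open U -> Ck k U f -> Ck k U g -> Ck k U (f \* g).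
Proof.
move=> oU; elim: k f g => [|k IH] f g.
  by move=> cf cg x Ux; apply: cvgM; [exact: cf|exact: cg].
move=> Cf Cg; have [df Df] := Cf; have [dg Dg] := Cg.
split=> [x Ux|v]; first by apply: differentiableM; [exact: df|exact: dg].
apply: (@eq_Ck _ _ _ _ _ ((f \* 'D_v g) \+ (g \* 'D_v f))) => //.
  move=> x Ux; rewrite deriveM //; apply: diff_derivable.
    exact: df.
  exact: dg.
by apply: CkD => //; apply: IH => //;
  [exact: CkW Cf|exact: Dg|exact: CkW Cg|exact: Df].
Qed.

Lemma Ck_cst {V W} k (U : set V) (a : W) : Ck k U (cst a).
Proof.
elim: k a => [|k IH] a /=; first by move=> x _; exact: cvg_cst.
split=> [x _|v]; first exact: differentiable_cst.
have -> : 'D_v (cst a : V -> W) = cst 0 by apply/funext => x; rewrite derive_cst.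
exact: IH.
Qed.

(** A differential depends only on the germ; this is needed because chart identities hold only near
    a point. *)
Lemma near_eq_diff {V W} {f g : V -> W} {x : V} (u : V) :
  (\near x, f x = g x) -> differentiable f x -> 'd g x u = 'd f x u.
Proof.
move=> fg df; rewrite -!deriveE //; first exact/esym/near_eq_derive.
exact: near_eq_differentiable fg df.
Qed.

Lemma diff_comp_linear {V V' W : normedModType R} {f : V' -> W}
    {L : {linear V -> V'}} {x : V} (u : V) :
  continuous L -> differentiable f (L x) ->
  'd (f \o L) x u = 'd f (L x) (L u).
Proof.
move=> cL df; rewrite diff_comp //=; last exact: linear_differentiable.
by rewrite diff_lin.
Qed.

Lemma diff_linear_comp {V V' W : normedModType R} {f : V -> V'}
    {L : {linear V' -> W}} {x : V} (u : V) :
  continuous L -> differentiable f x -> 'd (L \o f) x u = L ('d f x u).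
Proof.
move=> cL df; rewrite diff_comp //=; last exact: linear_differentiable.
by rewrite diff_lin.
Qed.

End Calculus.

(** * Positive definite symmetric bilinear forms on row vectors *)

Section InnerProduct.
Context {R : realFieldType} {n : nat}.
Variable g : 'rV[R]_n -> 'rV[R]_n -> R.
Hypothesis g_linear : forall k u v w, g (k *: u + v) w = k * g u w + g v w.
Hypothesis g_sym : forall u v, g u v = g v u.
Hypothesis g_pos : forall u, u != 0 -> 0 < g u u.

Lemma inner0l w : g 0 w = 0.
(* Linearity at [-1 *: 0 + 0] gives [g 0 w = - g 0 w + g 0 w]. *)
Proof. by have := g_linear (-1) 0 0 w; rewrite scaler0 addr0; lra. Qed.

Lemma inner_ge0 u : 0 <= g u u.
Proof. by have [->|/g_pos/ltW //] := eqVneq u 0; rewrite inner0l. Qed.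

Lemma innerZl k u w : g (k *: u) w = k * g u w.
Proof. by rewrite -[k *: u]addr0 g_linear inner0l addr0. Qed.

Lemma cauchy_schwarz u v : g u v ^+ 2 <= g u u * g v v.
Proof.
have [->|/g_pos vv] := eqVneq v 0.
  by rewrite g_sym !inner0l mulr0 expr2 mulr0.
(* [t *: v + u] is the component of [u] orthogonal to [v]; its nonnegative square, times [g v v],
   gives the inequality. *)
pose t := - (g u v / g v v).
have tv : t * g v v = - g u v by rewrite mulNr divfK // gt_eqF.
have := inner_ge0 (t *: v + u).
rewrite g_linear (g_sym v (_ + _)) (g_sym u (_ + _)) !g_linear (g_sym v u) tv.
rewrite addNr mulr0 add0r => h; have := mulr_ge0 h (ltW vv).
by rewrite mulrDl mulrAC tv mulNr -expr2 addrC subr_ge0.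
Qed.

(** [L u] lists the values of [g u] on the canonical basis. Positivity makes [L] injective, hence
    its square matrix invertible, so the row of values of [l] has a preimage. *)
Lemma riesz (l : {linear 'rV[R]_n -> R}) : exists u, forall v, g u v = l v.
Proof.
have lin : linear (fun u => \row_j g u 'e_j).
  by move=> k u v; apply/rowP => j; rewrite !mxE g_linear.
pose Lm := GRing.isLinear.Build _ _ _ _ _ lin.
pose L : {linear 'rV[R]_n -> 'rV[R]_n} := HB.pack (fun u => \row_j g u 'e_j) Lm.
have gE u v : g u v = \sum_j v 0 j * (L u) 0 j.
  rewrite [in LHS](row_sum_delta v) g_sym.
  elim/big_ind2: _ => [|x a y b <- <-|j _]; first by rewrite inner0l.
    by rewrite -[a]scale1r g_linear mul1r scale1r.
  by rewrite innerZl g_sym mxE.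
have Lfree : row_free (lin1_mx L).
  apply: inj_row_free => u; rewrite mul_rV_lin1 => Lu.
  apply/eqP; apply: contraT => /g_pos; rewrite gE Lu big1 ?ltxx // => j _.
  by rewrite mxE mulr0.
exists ((\row_j l 'e_j) *m invmx (lin1_mx L)) => v.
rewrite gE -mul_rV_lin1 mulmxKV -?row_free_unit //.
rewrite [in RHS](row_sum_delta v) linear_sum; apply: eq_bigr => j _.
by rewrite linearZ mxE.
Qed.

End InnerProduct.

(** * Gradients and Cauchy-Schwarz on a Riemannian manifold *)

Section Metric.
Context {R : realType} {n : nat} {M : manifold R n} {g : tensor2 M}.
Hypothesis hg : riemannian_metric g.

Lemma metric0l (p : M) (w : tangent p) : g p 0 w = 0.
Proof. by apply: (@inner0l _ _ (g p)); exact: (@metric_linear _ _ _ _ hg p). Qed.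

Lemma metricZl (p : M) (k : R) (u w : tangent p) : g p (k *: u) w = k * g p u w.
Proof. by apply: (@innerZl _ _ (g p)); exact: (@metric_linear _ _ _ _ hg p). Qed.

Lemma metric_ge0 (p : M) (u : tangent p) : 0 <= g p u u.
Proof.
apply: (@inner_ge0 _ _ (g p)); first exact: (@metric_linear _ _ _ _ hg p).
exact: (@metric_positive _ _ _ _ hg p).
Qed.

Lemma metric_cauchy_schwarz (p : M) (u v : tangent p) :
  g p u v ^+ 2 <= g p u u * g p v v.
Proof.
apply: (@cauchy_schwarz _ _ (g p)); first exact: (@metric_linear _ _ _ _ hg p).
  exact: (@metric_symmetric _ _ _ _ hg p).
exact: (@metric_positive _ _ _ _ hg p).
Qed.

(** [grad] is a choice with default 0; [riesz] supplies the existence that makes the chosen vector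
    represent the differential. *)
Lemma metric_grad (f : M -> R) (p : M) (v : tangent p) :
  g p (grad g f p) v = differential f v.
Proof.
suff : forall w : tangent p, g p (grad g f p) w = differential f w by exact.
apply: (@xgetPex _ _ [set u : tangent p |
    forall v : tangent p, g p u v = differential f v]).
apply: (@riesz _ _ (g p)); first exact: (@metric_linear _ _ _ _ hg p).
  exact: (@metric_symmetric _ _ _ _ hg p).
exact: (@metric_positive _ _ _ _ hg p).
Qed.

Lemma differential_grad (f : M -> R) (p : M) :
  differential f (grad g f p) = grad_norm2 g f p.
Proof. by rewrite -metric_grad. Qed.

Lemma differential_sqr_le (f : M -> R) (p : M) (v : tangent p) :
  differential f v ^+ 2 <= grad_norm2 g f p * g p v v.
Proof. by rewrite -metric_grad metric_cauchy_schwarz. Qed.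

End Metric.

(** * Changes of coordinates *)

Section Charts.
Context {R : realType} {n : nat} {M : manifold R n}.

Lemma coord_par_near (a : chart R n M) (p : M) :
  dom a p -> \forall x \near coord a p, id x = (coord a \o par a) x.
Proof.
move=> ap; apply: (@open_eq_near _ _ _ (cod a)) => [|x ax|].
- exact: open_cod.
- by rewrite /= parK.
- exact: coord_cod.
Qed.

Lemma transition_differentiable (a b : chart R n M) (x : 'rV[R]_n) :
  atlas a -> atlas b -> cod a x -> dom b (par a x) ->
  differentiable (coord b \o par a) x.
Proof.
move=> Aa Ab ax bx; have [df _] := chart_compat Aa Ab 1.
by apply: df; rewrite overlapE.
Qed.

Lemma smooth_differentiable (a : chart R n M) (f : M -> R) (x : 'rV[R]_n) :
  smooth_function f -> atlas a -> cod a x -> differentiable (f \o par a) x.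
Proof. by move=> sf Aa ax; have [df _] := sf a Aa 1; exact: df. Qed.

(** Chain rule through the chart chosen at the point. It turns the components of a differential in
    any chart of the atlas into directional derivatives, whose smoothness is known. *)
Lemma differential_chart_vector (a : chart R n M) (f : M -> R)
    (x u : 'rV[R]_n) :
  smooth_function f -> atlas a -> cod a x ->
  differential f (chart_vector a x u) = 'D_u (f \o par a) x.
Proof.
move=> sf Aa ax; rewrite /differential /chart_vector.
have Ab := chart_at_atlas (par a x); have bx := mem_chart_at (par a x).
move: (chart_at (par a x)) Ab bx => b Ab bx.
have dt : differentiable (coord b \o par a) x.
  exact: transition_differentiable.
have df : differentiable (f \o par b) ((coord b \o par a) x).
  by apply: smooth_differentiable => //; exact: coord_cod.
rewrite deriveE; last exact: smooth_differentiable.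
rewrite -[LHS]/(('d (f \o par b) ((coord b \o par a) x)
  \o 'd (coord b \o par a) x) u) -diff_comp //.
apply/esym/near_eq_diff; last exact: differentiable_comp.
(* The two local expressions of [f] are compared on the overlap of the charts, which is open. *)
apply: (@open_eq_near _ _ _ _ _ _ (@open_overlap _ _ _ a b)).
  by move=> y; rewrite overlapE => -[ay by_] /=; rewrite coordK.
by rewrite overlapE.
Qed.

End Charts.

(** * Tangent vectors of the product as pairs of blocks *)

Section ProductTangent.
Context {R : realType} {n1 n2 : nat} {M1 : manifold R n1} {M2 : manifold R n2}.
Local Notation M := (prod_manifold M1 M2).

(** The chart chosen at [p] is the product of those chosen at its components, so the projection
    reads as [lsubmx] followed by a map that is the identity near the base point. *)
Lemma tangent_map_projection1 (p : M) (u : tangent p) :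
  tangent_map (@projection1 _ _ _ M1 M2) u = lsubmx u.
Proof.
have E := coord_par_near _ _ (mem_chart_at p.1).
rewrite /tangent_map /=.
have -> : coord (chart_at p.1) \o (@projection1 _ _ _ M1 M2) \o par (chart_at p) =
    (coord (chart_at p.1) \o par (chart_at p.1)) \o lsubmx by [].
rewrite diff_comp_linear; first last.
- by rewrite /= row_mxKl; apply: near_eq_differentiable E _;
  exact: ex_diff.
- exact: continuous_lsubmx.
by rewrite /= row_mxKl (near_eq_diff _ E) ?diff_val //; exact: ex_diff.
Qed.

Lemma tangent_map_projection2 (p : M) (u : tangent p) :
  tangent_map (@projection2 _ _ _ M1 M2) u = rsubmx u.
Proof.
have E := coord_par_near _ _ (mem_chart_at p.2).
rewrite /tangent_map /=.
have -> : coord (chart_at p.2) \o (@projection2 _ _ _ M1 M2) \o par (chart_at p) =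
    (coord (chart_at p.2) \o par (chart_at p.2)) \o rsubmx by [].
rewrite diff_comp_linear; first last.
- by rewrite /= row_mxKr; apply: near_eq_differentiable E _;
  exact: ex_diff.
- exact: continuous_rsubmx.
by rewrite /= row_mxKr (near_eq_diff _ E) ?diff_val //; exact: ex_diff.
Qed.

Lemma differential_horizontal_lift (f : M1 -> R) (p : M) (u : tangent p) :
  smooth_function f ->
  differential (horizontal_lift f) u
  = differential f (lsubmx u : tangent p.1).
Proof.
move=> sf; rewrite /differential /=.
have -> : horizontal_lift f \o par (chart_at p) =
    (f \o par (chart_at p.1)) \o lsubmx by [].
rewrite diff_comp_linear; first by rewrite /= row_mxKl.
  exact: continuous_lsubmx.
rewrite /= row_mxKl; apply: smooth_differentiable => //.
  exact: chart_at_atlas.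
by apply: coord_cod; exact: mem_chart_at.
Qed.

Lemma differential_vertical_lift (f : M2 -> R) (p : M) (u : tangent p) :
  smooth_function f ->
  differential (vertical_lift f) u
  = differential f (rsubmx u : tangent p.2).
Proof.
move=> sf; rewrite /differential /=.
have -> : vertical_lift f \o par (chart_at p) =
    (f \o par (chart_at p.2)) \o rsubmx by [].
rewrite diff_comp_linear; first by rewrite /= row_mxKr.
  exact: continuous_rsubmx.
rewrite /= row_mxKr; apply: smooth_differentiable => //.
  exact: chart_at_atlas.
by apply: coord_cod; exact: mem_chart_at.
Qed.

Section ChartVector.
Variables (a : chart R n1 M1) (b : chart R n2 M2) (x u : 'rV[R]_(n1 + n2)).
Hypotheses (Aa : atlas a) (Ab : atlas b) (abx : cod (prod_chart a b) x).

Let c : chart R (n1 + n2) M := prod_chart a b.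

Let transition : 'rV[R]_(n1 + n2) -> 'rV[R]_(n1 + n2) :=
  coord (chart_at (par c x)) \o par c.

Let transition_diff : differentiable transition x.
Proof.
apply: transition_differentiable => //; last exact: mem_chart_at.
  by exists (a, b).
exact: chart_at_atlas.
Qed.

(** A transition between product charts acts blockwise: its left block factors through [lsubmx]. *)
Lemma lsubmx_chart_vector :
  lsubmx (chart_vector c x u) = chart_vector a (lsubmx x) (lsubmx u).
Proof.
rewrite /chart_vector.
rewrite -(diff_linear_comp u (@continuous_lsubmx _ _ _ _) transition_diff).
have -> : lsubmx \o transition =
    (coord (chart_at (par a (lsubmx x))) \o par a) \o lsubmx.
  by apply/funext => y; rewrite /transition /= row_mxKl.
apply: diff_comp_linear; first exact: continuous_lsubmx.
apply: transition_differentiable => //; [exact: chart_at_atlas|exact: abx.1|].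
exact: mem_chart_at.
Qed.

Lemma rsubmx_chart_vector :
  rsubmx (chart_vector c x u) = chart_vector b (rsubmx x) (rsubmx u).
Proof.
rewrite /chart_vector.
rewrite -(diff_linear_comp u (@continuous_rsubmx _ _ _ _) transition_diff).
have -> : rsubmx \o transition =
    (coord (chart_at (par b (rsubmx x))) \o par b) \o rsubmx.
  by apply/funext => y; rewrite /transition /= row_mxKr.
apply: diff_comp_linear; first exact: continuous_rsubmx.
apply: transition_differentiable => //; [exact: chart_at_atlas|exact: abx.2|].
exact: mem_chart_at.
Qed.

End ChartVector.

Lemma doubly_warped_tensorE (g1 : tensor2 M1) (g2 : tensor2 M2) (f1 : M1 -> R)
    (f2 : M2 -> R) (c : R) (p : M) (u v : tangent p) :
  smooth_function f1 -> smooth_function f2 ->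
  doubly_warped_tensor g1 g2 f1 f2 c u v =
  f2 p.2 ^+ 2 * g1 p.1 (lsubmx u) (lsubmx v)
  + f1 p.1 ^+ 2 * g2 p.2 (rsubmx u) (rsubmx v)
  + c * f1 p.1 * f2 p.2
    * (differential f1 (lsubmx u : tangent p.1)
       * differential f2 (rsubmx v : tangent p.2)
       + differential f2 (rsubmx u : tangent p.2)
         * differential f1 (lsubmx v : tangent p.1)).
Proof.
move=> sf1 sf2.
rewrite /doubly_warped_tensor /pullback /symmetric_product /tensor_product.
rewrite !tangent_map_projection1 !tangent_map_projection2.
by rewrite !differential_horizontal_lift // !differential_vertical_lift.
Qed.

End ProductTangent.

(* With [a = |u1|^2], [b = |u2|^2], [s = df1 u1] and [t = df2 u2], the conclusion
   is that the warped tensor is positive on [(u1, u2)]. *)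
Lemma warped_form_gt0 {R : realFieldType} (a b s t P Q x y c : R) :
  0 <= a -> 0 <= b -> (0 < a) || (0 < b) -> 0 < x -> 0 < y ->
  s ^+ 2 <= P * a -> t ^+ 2 <= Q * b -> c ^+ 2 * P * Q < 1 ->
  0 < y ^+ 2 * a + x ^+ 2 * b + c * x * y * (s * t + t * s).
Proof.
move=> a0 b0 ab x0 y0 sP tQ cPQ.
(* If one of [a], [b] vanishes, so does the cross term; this is settled first, since [key] is strict
   only for [a * b > 0]. *)
have s0 : a = 0 -> s = 0.
  move=> aE; apply/eqP; rewrite -sqrf_eq0 eq_le sqr_ge0 andbT.
  by rewrite (le_trans sP) // aE mulr0.
have t0 : b = 0 -> t = 0.
  move=> bE; apply/eqP; rewrite -sqrf_eq0 eq_le sqr_ge0 andbT.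
  by rewrite (le_trans tQ) // bE mulr0.
have x20 : 0 < x ^+ 2 by rewrite exprn_gt0.
have y20 : 0 < y ^+ 2 by rewrite exprn_gt0.
move: a0; rewrite le_eqVlt => /predU1P[aE|a0].
  move: ab; rewrite -aE ltxx /= s0 // => b1.
  by rewrite !mulr0 mul0r !addr0 add0r mulr0 addr0 mulr_gt0.
move: b0; rewrite le_eqVlt => /predU1P[bE|b0].
  by rewrite -bE t0 // !(mulr0, mul0r, addr0) mulr_gt0.
have key : (c * s * t) ^+ 2 < a * b.
  have st : s ^+ 2 * t ^+ 2 <= (P * a) * (Q * b).
    by apply: ler_pM => //; exact: sqr_ge0.
  apply: (@le_lt_trans _ _ ((c ^+ 2 * P * Q) * (a * b))).
    have := ler_wpM2l (sqr_ge0 c) st; rewrite -!exprMn !mulrA.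
    suff -> : c ^+ 2 * P * a * Q * b = c ^+ 2 * P * Q * a * b by [].
    by ring.
  by rewrite gtr_pMl // mulr_gt0.
set z := c * s * t in key.
have -> : c * x * y * (s * t + t * s) = 2 * (x * y) * z by rewrite /z; ring.
set A := y ^+ 2 * a + x ^+ 2 * b.
have A0 : 0 < A by rewrite addr_gt0 // mulr_gt0.
(* Arithmetic-geometric mean inequality for the two terms of [A], squared to avoid roots. *)
have AB : 4 * ((x * y) ^+ 2 * (a * b)) <= A ^+ 2.
  rewrite -subr_ge0.
  have -> : A ^+ 2 - 4 * ((x * y) ^+ 2 * (a * b)) =
      (y ^+ 2 * a - x ^+ 2 * b) ^+ 2 by rewrite /A; ring.
  exact: sqr_ge0.
have xy0 : 0 < (x * y) ^+ 2 by rewrite exprn_gt0 // mulr_gt0.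
have lt2 : (2 * (x * y) * z) ^+ 2 < A ^+ 2.
  apply: lt_le_trans AB.
  have -> : (2 * (x * y) * z) ^+ 2 = 4 * ((x * y) ^+ 2 * z ^+ 2) by ring.
  by rewrite ltr_pM2l // ltr_pM2l.
have : `|2 * (x * y) * z| < A.
  by rewrite -(ltr_pXn2r (n := 2)) ?nnegrE ?(ltW A0) // real_normK // num_real.
by rewrite ltr_norml => /andP[+ _]; rewrite -subr_gt0 opprK addrC.
Qed.

(** * Equivalence of the metric axioms and the gradient bound *)

Theorem proposition1 (R : realType) (n1 n2 : nat)
    (M1 : manifold R n1) (M2 : manifold R n2)
    (g1 : tensor2 M1) (g2 : tensor2 M2)
    (hg1 : riemannian_metric g1) (hg2 : riemannian_metric g2)
    (f1 : M1 -> R) (f2 : M2 -> R)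
    (hf1 : smooth_function f1) (hf2 : smooth_function f2)
    (f1_gt0 : forall p : M1, 0 < f1 p) (f2_gt0 : forall p : M2, 0 < f2 p)
    (c : R) :
  riemannian_metric (doubly_warped_tensor g1 g2 f1 f2 c) <->
  (forall p : prod_manifold M1 M2,
     0 <= c ^+ 2 * horizontal_lift (grad_norm2 g1 f1) p
               * vertical_lift (grad_norm2 g2 f2) p < 1).
Proof.
split=> [hG p|cPQ].
  rewrite /horizontal_lift /vertical_lift /=.
  set P := grad_norm2 g1 f1 p.1; set Q := grad_norm2 g2 f2 p.2.
  have P0 : 0 <= P by exact: metric_ge0.
  have Q0 : 0 <= Q by exact: metric_ge0.
  have -> /= : 0 <= c ^+ 2 * P * Q.
    by apply: mulr_ge0 => //; apply: mulr_ge0 => //; exact: sqr_ge0.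
  (* For [Q = 0] the bound is trivial; otherwise [v], and with it the test vector [w], is
     nonzero. *)
  have [->|QN0] := eqVneq Q 0; first by rewrite mulr0 ltr01.
  have Qgt0 : 0 < Q by rewrite lt_def QN0.
  pose u : 'rV[R]_n1 := grad g1 f1 p.1; pose v : 'rV[R]_n2 := grad g2 f2 p.2.
  have v0 : v != 0.
    apply: contra_neq QN0 => vE; rewrite /Q /grad_norm2 -/v vE.
    exact: (metric0l hg2).
  (* With the coefficient of [v] fixed at [1 / f1], that of [u] minimises the resulting quadratic
     polynomial. *)
  pose w : tangent p := row_mx (- (c * Q / f2 p.2) *: u) ((f1 p.1)^-1 *: v).
  have w0 : w != 0.
    apply: contra_neq v0 => wE.
    have : rsubmx w = 0 by rewrite wE linear0.
    rewrite row_mxKr => /eqP; rewrite scaler_eq0 invr_eq0 gt_eqF //=.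
    by move=> /eqP.
  have := metric_positive hG w0.
  rewrite doubly_warped_tensorE // row_mxKl row_mxKr.
  have sq1 k : g1 p.1 (k *: u) (k *: u) = k ^+ 2 * P.
    by rewrite (metricZl hg1) (metric_symmetric hg1) (metricZl hg1) mulrA -expr2.
  have sq2 k : g2 p.2 (k *: v) (k *: v) = k ^+ 2 * Q.
    by rewrite (metricZl hg2) (metric_symmetric hg2) (metricZl hg2) mulrA -expr2.
  have d1 k : differential f1 (k *: u : tangent p.1) = k * P.
    by rewrite /differential linearZ; congr (_ * _); exact: differential_grad.
  have d2 k : differential f2 (k *: v : tangent p.2) = k * Q.
    by rewrite /differential linearZ; congr (_ * _); exact: differential_grad.
  rewrite sq1 sq2 d1 d2.
  have F1 : f1 p.1 != 0 by rewrite gt_eqF.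
  have F2 : f2 p.2 != 0 by rewrite gt_eqF.
  set lhs := (X in 0 < X -> _).
  have -> : lhs = Q * (1 - c ^+ 2 * P * Q).
    by rewrite /lhs; field; apply/andP; split.
  by rewrite pmulr_rgt0 // subr_gt0.
split=> [p k u v w|p u v|p u u0|_ u v [[a b] [/= Aa Ab] <-]].
- rewrite !doubly_warped_tensorE // !linearP /differential.
  rewrite (metric_linear hg1) (metric_linear hg2) !linearP /=.
  by rewrite /GRing.scale /=; ring.
- rewrite !doubly_warped_tensorE // (metric_symmetric hg1).
  by rewrite (metric_symmetric hg2); ring.
- rewrite doubly_warped_tensorE //.
  have /andP[_ cPQ1] := cPQ p.
  apply: (warped_form_gt0 _ _ _ _ (grad_norm2 g1 f1 p.1)
    (grad_norm2 g2 f2 p.2)) => //.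
  + exact: metric_ge0.
  + exact: metric_ge0.
  (* A nonzero vector has a nonzero block, so one of the two squared lengths is positive. *)
  + have [lu|lu] := eqVneq (lsubmx u) 0; last first.
      by rewrite (metric_positive hg1 (p := p.1) lu).
    rewrite (metric_positive hg2 (p := p.2)) ?orbT //.
    apply: contra_neq u0 => ru.
    by rewrite -[u]hsubmxK lu ru row_mx0.
  + exact: differential_sqr_le.
  + exact: differential_sqr_le.
- move=> k; set C : chart R (n1 + n2) (prod_manifold M1 M2) := prod_chart a b.
  have oC : open (cod C) by exact: open_cod.
  have liftl (h : 'rV[R]_n1 -> R) : Ck k (cod a) h -> Ck k (cod C) (h \o lsubmx).
    move=> /(Ck_comp_linear (@continuous_lsubmx _ _ _ _)) Ch.
    by apply: sub_Ck (Ch _) => x [].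
  have liftr (h : 'rV[R]_n2 -> R) : Ck k (cod b) h -> Ck k (cod C) (h \o rsubmx).
    move=> /(Ck_comp_linear (@continuous_rsubmx _ _ _ _)) Ch.
    by apply: sub_Ck (Ch _) => x [].
  pose F1 := (f1 \o par a) \o lsubmx : 'rV[R]_(n1 + n2) -> R.
  pose F2 := (f2 \o par b) \o rsubmx : 'rV[R]_(n1 + n2) -> R.
  (* [D1 w] and [D2 w] are the chart expressions of the two differentials along the constant
     components [w]. *)
  pose D1 (w : 'rV[R]_(n1 + n2)) : 'rV[R]_(n1 + n2) -> R :=
    'D_(lsubmx w) (f1 \o par a) \o lsubmx.
  pose D2 (w : 'rV[R]_(n1 + n2)) : 'rV[R]_(n1 + n2) -> R :=
    'D_(rsubmx w) (f2 \o par b) \o rsubmx.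
  pose G1 := (fun x => g1 (par a x) (chart_vector a x (lsubmx u))
    (chart_vector a x (lsubmx v))) \o lsubmx : 'rV[R]_(n1 + n2) -> R.
  pose G2 := (fun x => g2 (par b x) (chart_vector b x (rsubmx u))
    (chart_vector b x (rsubmx v))) \o rsubmx : 'rV[R]_(n1 + n2) -> R.
  have CF1 : Ck k (cod C) F1 by apply: liftl; exact: hf1.
  have CF2 : Ck k (cod C) F2 by apply: liftr; exact: hf2.
  (* Differentiation costs one order, so smoothness of [f1] is used at order [k.+1]. *)
  have CD1 w : Ck k (cod C) (D1 w).
    by apply: liftl; have [_] := hf1 a Aa k.+1; exact.
  have CD2 w : Ck k (cod C) (D2 w).
    by apply: liftr; have [_] := hf2 b Ab k.+1; exact.
  have CG1 : Ck k (cod C) G1 by apply: liftl; exact: metric_smooth.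
  have CG2 : Ck k (cod C) G2 by apply: liftr; exact: metric_smooth.
  (* On [cod C] the component of the tensor is a polynomial in these C^k functions. *)
  apply: (@eq_Ck _ _ _ _ _ (((F2 \* F2) \* G1 \+ (F1 \* F1) \* G2) \+
    ((cst c \* F1) \* F2) \* ((D1 u \* D2 v) \+ (D2 u \* D1 v)))) => //.
    move=> x Cx; rewrite doubly_warped_tensorE //.
    rewrite !lsubmx_chart_vector // !rsubmx_chart_vector //.
    have [Cl Cr] := Cx.
    by rewrite !differential_chart_vector.
  by do ?[apply: CkD => //|apply: CkM => //]; exact: Ck_cst.
Qed.
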